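(* In the AI-augmented cascade model with symmetric prior $\ell_0 = 0$ and $q,\alpha \in (\tfrac12,1)$, the initial public log-odds $P_1$ lies in the learning region $(-L_q, L_q)$ if and only if $\alpha < q$. If $\alpha \ge q$, then $P_1$ lies in a cascade region, with the direction determined by the AI prediction $c$: $P_1 \ge L_q$ when $c=1$ and $P_1 \le -L_q$ when $c=0$.
   Context: AI-augmented cascade model. A binary state $\theta\in\{0,1\}$ has prior $\pi_0=\Pr(\theta=1)\in(0,1)$, $\ell_0=\log\frac{\pi_0}{1-\pi_0}$. Users $i=1,2,\dots$ act sequentially. User $i$ has a private signal $s_i\in\{0,1\}$ with $\Pr(s_i=\theta\mid\theta)=q$; there is one common AI signal $c\in\{0,1\}$ with $\Pr(c=\theta\mid\theta)=\alpha$, seen by every user; given $\theta$, the variables $c,s_1,s_2,\dots$ are mutually independent. Write $L_\rho=\log\frac{\rho}{1-\rho}$ and $\lambda(x;\rho)=(2x-1)L_\rho$ for $x\in\{0,1\}$, $\rho\in(\tfrac12,1)$. The public log-odds of user $i$ are $P_i=\ell_0+\lambda(c;\alpha)+\sum_{j<i}\psi_j(J_j)$, where $J_j$ is the judgment of user $j$ and $\psi_j(J_j)=\log\frac{\Pr(J_j\mid\theta=1,P_j)}{\Pr(J_j\mid\theta=0,P_j)}$; in particular $P_1=\ell_0+\lambda(c;\alpha)$. The learning region is $(-L_q,L_q)$; the cascade regions are $\{P\ge L_q\}$ (up-cascade) and $\{P\le -L_q\}$ (down-cascade); the boundary points belong to the cascade regions because ties are broken toward the public component. *)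

(* Defs.v *)
From HB Require Import structures.
From mathcomp Require Import all_boot all_order all_algebra.
From mathcomp Require Import all_classical all_reals all_analysis.

Set Implicit Arguments.
Unset Strict Implicit.
Unset Printing Implicit Defensive.

Import Order.TTheory GRing.Theory Num.Theory.

Local Open Scope classical_set_scope.
Local Open Scope ring_scope.

Section LogOdds.
Context {R : realType}.

Definition logodds (rho : R) : R := ln (rho / (1 - rho)).

Definition lambda (x : bool) (rho : R) : R := (2 * x%:R - 1) * logodds rho.

Definition learning_region (q : R) : set R :=
  [set p | - logodds q < p < logodds q].

Definition up_cascade (q : R) : set R := [set p | logodds q <= p].

Definition down_cascade (q : R) : set R := [set p | p <= - logodds q].

Definition cascade_region (q : R) : set R := up_cascade q `|` down_cascade q.

End LogOdds.

Section Conditioning.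
Context (d : measure_display) (T : measurableType d) (R : realType).
Variable Pr : probability T R.

(* Equal to 0 when the conditioning event is null. *)
Definition cprob (A B : set T) : R := fine (Pr (A `&` B)) / fine (Pr B).

Definition cond_mutually_independent (I : eqType) (X : I -> T -> bool)
    (B : set T) : Prop :=
  forall (r : seq I) (V : I -> set bool), uniq r ->
    cprob (\big[setI/setT]_(i <- r) (X i @^-1` V i)) B =
    \prod_(i <- r) cprob (X i @^-1` V i) B.

End Conditioning.

(* The state and the binary signals are random variables, [true] standing for
   1 and [false] for 0.  Users are numbered from 1: [signal 0] is unused and
   unconstrained, and index 0 of the jointly independent family is given to
   the AI signal. *)
Record cascade_model (d : measure_display) (T : measurableType d)
    (R : realType) (Pr : probability T R) (q alpha : R) := CascadeModel {
  state : {RV Pr >-> bool};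
  ai : {RV Pr >-> bool};
  signal : nat -> {RV Pr >-> bool};
  prior_itv : 0 < fine (Pr (state @^-1` [set true])) < 1;
  ai_accuracy : forall t : bool,
    cprob Pr (ai @^-1` [set t]) (state @^-1` [set t]) = alpha;
  signal_accuracy : forall (i : nat) (t : bool), (0 < i)%N ->
    cprob Pr (signal i @^-1` [set t]) (state @^-1` [set t]) = q;
  signals_independent : forall t : bool,
    cond_mutually_independent Pr
      (fun i : nat => if i == 0 then (ai : T -> bool) else signal i)
      (state @^-1` [set t])
}.

Section CascadeDynamics.
Context (d : measure_display) (T : measurableType d) (R : realType).
Context (Pr : probability T R) (q alpha : R).
Variable M : cascade_model Pr q alpha.

Definition prior : R := fine (Pr (state M @^-1` [set true])).

Definition prior_logodds : R := logodds prior.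

(* The judgment of a user with public log-odds [p] and private signal [s]:
   the state favoured by the posterior log-odds [p + lambda s q], a tie being
   resolved in favour of the state indicated by [p]. *)
Definition decision (p : R) (s : bool) : bool :=
  let post := p + lambda s q in
  (0 < post) || ((post == 0) && (0 < p)).

(* Given the public log-odds [P] and the judgment [J] of a user,
   [judgment_llr P J p x] is the log-likelihood ratio of the judgment [x]
   when the public log-odds equal [p]. *)
Definition judgment_llr (P : T -> R) (J : T -> bool) (p : R) (x : bool) : R :=
  ln (cprob Pr (J @^-1` [set x]) (state M @^-1` [set true] `&` P @^-1` [set p])
    / cprob Pr (J @^-1` [set x])
        (state M @^-1` [set false] `&` P @^-1` [set p])).

Definition public_of (H : T -> R) (w : T) : R :=
  prior_logodds + lambda (ai M w) alpha + H w.

(* Evidence accumulated from the judgments of users 1, ..., k. *)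
Fixpoint history (k : nat) : T -> R :=
  if k is k'.+1 then
    let P := public_of (history k') in
    let J := fun w => decision (P w) (signal M k w) in
    fun w => history k' w + judgment_llr P J (P w) (J w)
  else fun=> 0.

Definition public_logodds (i : nat) : T -> R := public_of (history i.-1).

Definition judgment (i : nat) (w : T) : bool :=
  decision (public_logodds i w) (signal M i w).

Definition psi (i : nat) (w : T) : R :=
  judgment_llr (public_logodds i) (judgment i)
    (public_logodds i w) (judgment i w).

Lemma public_logoddsE (i : nat) (w : T) :
  public_logodds i w =
  prior_logodds + lambda (ai M w) alpha + \sum_(1 <= j < i) psi j w.
Proof.
rewrite /public_logodds /public_of; congr (_ + _).
case: i => [|k] /=; first by rewrite big_geq.
elim: k => [|k IHk]; first by rewrite big_geq.
by rewrite big_nat_recr //= -IHk.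
Qed.

End CascadeDynamics.

(* Main.v *)
Require Import Defs.
From HB Require Import structures.
From mathcomp Require Import all_boot all_order all_algebra.
From mathcomp Require Import all_classical all_reals all_analysis.
From mathcomp Require Import ring lra.

Import Order.TTheory GRing.Theory Num.Theory.

Local Open Scope classical_set_scope.
Local Open Scope ring_scope.

(** Before any judgment is observed and with zero prior log-odds, the public evidence is the AI term
    alone: $P_1 = \pm L_\alpha$, the sign being that of the prediction $c$. As $\rho \mapsto L_\rho$
    is strictly increasing on $(0,1)$ ([ltr_logodds]) and positive above $1/2$ ([logodds_gt0]),
    placing $\pm L_\alpha$ relative to $\pm L_q$ amounts to comparing $\alpha$ with $q$. *)

Lemma ltr_logodds (R : realType) :
  {in `]0, 1[ &, {mono @logodds R : x y / x < y}}.
Proof.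
move=> x y; rewrite !in_itv /= => /andP[x0 x1] /andP[y0 y1].
rewrite /logodds ltr_ln ?posrE ?divr_gt0 ?subr_gt0//.
rewrite ltr_pdivrMr ?subr_gt0// mulrAC ltr_pdivlMr ?subr_gt0//.
(* After cross-multiplication the $xy$ terms of $x(1-y) < y(1-x)$ cancel. *)
by apply/idP/idP => ?; lra.
Qed.

Lemma ler_logodds (R : realType) :
  {in `]0, 1[ &, {mono @logodds R : x y / x <= y}}.
Proof. by move=> x y x01 y01; rewrite !leNgt ltr_logodds. Qed.

Lemma logodds_gt0 (R : realType) (x : R) : 1 / 2 < x < 1 -> 0 < logodds x.
Proof.
move=> /andP[x12 x1]; rewrite /logodds ln_gt0// ltr_pdivlMr ?subr_gt0//; lra.
Qed.

Lemma lambda_true (R : realType) (rho : R) : lambda true rho = logodds rho.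
Proof. by rewrite /lambda /=; ring. Qed.

Lemma lambda_false (R : realType) (rho : R) : lambda false rho = - logodds rho.
Proof. by rewrite /lambda /=; ring. Qed.

(** No user precedes user 1, so the sum of [psi] over $1 \le j < 1$ is empty. *)
Lemma public_logodds1 (d : measure_display) (T : measurableType d)
    (R : realType) (Pr : probability T R) (q alpha : R)
    (M : cascade_model Pr q alpha) (w : T) :
  public_logodds M 1 w = prior_logodds M + lambda (ai M w) alpha.
Proof. by rewrite public_logoddsE big_geq// addr0. Qed.

Theorem corollary3 (d : measure_display) (T : measurableType d) (R : realType)
    (Pr : probability T R) (q alpha : R) (M : cascade_model Pr q alpha)
    (q_itv : 1 / 2 < q < 1) (alpha_itv : 1 / 2 < alpha < 1)
    (symmetric_prior : prior_logodds M = 0) :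
  forall w : T,
    (learning_region q (public_logodds M 1 w) <-> alpha < q) /\
    (q <= alpha ->
      cascade_region q (public_logodds M 1 w) /\
      (ai M w = true -> up_cascade q (public_logodds M 1 w)) /\
      (ai M w = false -> down_cascade q (public_logodds M 1 w))).
Proof.
move=> w; rewrite public_logodds1 symmetric_prior add0r.
have q01 : q \in `]0, 1[ by rewrite in_itv /=; lra.
have a01 : alpha \in `]0, 1[ by rewrite in_itv /=; lra.
(* Positivity gives the far bound of the learning region: if $0 < L_\alpha < L_q$, then also $-L_q <
   L_\alpha$, and symmetrically for $-L_\alpha$. *)
have a_gt0 := logodds_gt0 _ _ alpha_itv.
(* From here on everything is linear in [logodds q] and [logodds alpha]. *)
rewrite -(ltr_logodds _ _ _ a01 q01) -(ler_logodds _ _ _ q01 a01).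
rewrite /cascade_region /learning_region /up_cascade /down_cascade /=.
case: (ai M w); rewrite ?lambda_true ?lambda_false.
- split; first by split=> ?; lra.
  (* The tie $\alpha = q$ is included because the cascade regions are closed. *)
  by move=> qa; split; [left|].
- split; first by split=> ?; lra.
  by move=> qa; rewrite lerN2; split; [right|].
Qed.
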